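(* Let $A,B,\Omega\in\mathbb{R}^{n\times n}$ and let $A=M-N$ with $M+\Omega$ nonsingular. If $$\Vert(M+\Omega)^{-1}(N+\Omega)\Vert+\Vert(M+\Omega)^{-1}B\Vert<1,$$ then for any $b\in\mathbb{R}^n$ the equation $Ax-B|x|-b=0$ has a unique solution $x^*\in\mathbb{R}^n$, and the sequence $\{x^{(k)}\}_{k=0}^\infty$ generated by the NMS iteration converges to $x^*$.
   Context: For $x\in\mathbb{R}^n$, $|x|$ is the componentwise absolute value. $\Vert\cdot\Vert$ is the matrix 2-norm. The NMS (Newton-based matrix splitting) iteration starts from an arbitrary $x^{(0)}\in\mathbb{R}^n$ and is $x^{(k+1)}=(M+\Omega)^{-1}[(N+\Omega)x^{(k)}+B|x^{(k)}|+b]$, $k=0,1,2,\dots$. *)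

(* Defs.v *)
From HB Require Import structures.
From mathcomp Require Export all_boot all_order all_algebra.
From mathcomp Require Export all_classical all_reals all_analysis.
Export numFieldNormedType.Exports.

Set Implicit Arguments.
Unset Strict Implicit.
Unset Printing Implicit Defensive.

Import Order.TTheory GRing.Theory Num.Theory.
Local Open Scope classical_set_scope.
Local Open Scope ring_scope.

Section Norms.
Context {R : realType}.

Definition absv n (x : 'cV[R]_n) : 'cV[R]_n := map_mx Num.norm x.

Definition norm2 n (x : 'cV[R]_n) : R := Num.sqrt (\sum_(i < n) x i 0 ^+ 2).

(* Spectral norm, as the operator norm induced by the Euclidean norm.  The
   norm provided by the library on matrices is the largest absolute value of
   the entries.  [sup] is 0 by convention on sets without a supremum; by
   [opnorm2_has_sup] this only happens for n = 0. *)
Definition opnorm2 m n (A : 'M[R]_(m, n)) : R :=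
  sup [set norm2 (A *m x) / norm2 x | x in [set x : 'cV[R]_n | x != 0]].

Lemma norm2_ge0 n (x : 'cV[R]_n) : 0 <= norm2 x.
Proof. exact: sqrtr_ge0. Qed.

Lemma ler_norm2_coord n (x : 'cV[R]_n) i : `|x i 0| <= norm2 x.
Proof.
rewrite -sqrtr_sqr ler_wsqrtr // (bigD1 i) //= lerDl.
by apply: sumr_ge0 => j _; exact: sqr_ge0.
Qed.

Lemma norm2_le_sum n (x : 'cV[R]_n) : norm2 x <= \sum_(i < n) `|x i 0|.
Proof.
have s0 : 0 <= \sum_(i < n) `|x i 0| by apply: sumr_ge0.
rewrite -[leRHS](ger0_norm s0) -sqrtr_sqr ler_wsqrtr //.
rewrite expr2 mulr_suml ler_sum // => i _.
rewrite -real_normK ?num_real// expr2 ler_wpM2l // (bigD1 i) //= lerDl.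
by apply: sumr_ge0.
Qed.

Lemma norm2_mulmx_le m n (A : 'M[R]_(m, n)) (x : 'cV[R]_n) :
  norm2 (A *m x) <= (\sum_(i < m) \sum_(j < n) `|A i j|) * norm2 x.
Proof.
apply: (le_trans (norm2_le_sum _)); rewrite mulr_suml ler_sum // => i _.
rewrite mxE mulr_suml (le_trans (ler_norm_sum _ _ _)) // ler_sum // => j _.
by rewrite normrM ler_wpM2l // ler_norm2_coord.
Qed.

Lemma opnorm2_has_sup m n (A : 'M[R]_(m, n.+1)) :
  has_sup [set norm2 (A *m x) / norm2 x | x in [set x : 'cV[R]_n.+1 | x != 0]].
Proof.
split.
  exists (norm2 (A *m const_mx 1) / norm2 (const_mx 1 : 'cV[R]_n.+1)).
  exists (const_mx 1) => //=; apply/eqP => /matrixP/(_ 0 0)/eqP.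
  by rewrite !mxE oner_eq0.
exists (\sum_(i < m) \sum_(j < n.+1) `|A i j|) => _ [x /= x0 <-].
have nx : 0 < norm2 x.
  rewrite lt_neqAle norm2_ge0 andbT eq_sym; apply: contra_neq x0 => nx0.
  apply/matrixP => i j; rewrite (ord1 j) mxE; apply/normr0_eq0/eqP.
  by rewrite eq_le normr_ge0 andbT -nx0 ler_norm2_coord.
by rewrite ler_pdivrMr // norm2_mulmx_le.
Qed.

End Norms.

Section NMS.
Context {R : realType}.

Definition nms_step n (M N Om B : 'M[R]_n) (b x : 'cV[R]_n) : 'cV[R]_n :=
  invmx (M + Om) *m ((N + Om) *m x + B *m absv x + b).

Definition nms n (M N Om B : 'M[R]_n) (b x0 : 'cV[R]_n) (k : nat) : 'cV[R]_n :=
  iter k (nms_step M N Om B b) x0.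

End NMS.

(* Main.v *)
Require Import Defs.

From mathcomp Require Import ring.

Set Implicit Arguments.
Unset Strict Implicit.
Unset Printing Implicit Defensive.

Import Order.TTheory GRing.Theory Num.Theory.
Local Open Scope classical_set_scope.
Local Open Scope ring_scope.

(** With [A = M - N], the equation [A x - B |x| - b = 0] says that [(M + Om) x]
    equals [(N + Om) x + B |x| + b], that is, that [x] is fixed by the iteration
    map
    [x |-> (M + Om)^-1 ((N + Om) x + B |x| + b)] (lemma [nms_step_fixP]).  The
    difference of two values of this map is
    [P (x - y) + Q (|x| - |y|)] with [P = (M + Om)^-1 (N + Om)] and
    [Q = (M + Om)^-1 B].  Taking absolute values entrywise does not increase
    Euclidean distances, so the map is Lipschitz with constant
    [opnorm2 P + opnorm2 Q < 1] ([nms_step_lipschitz]), and the Banach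
    fixed-point principle gives the unique solution and the convergence of the
    iterates from every starting point.

    The map contracts Euclidean distances but need not contract distances in
    the norm of the largest entry, which induces the topology of matrices, so
    the fixed-point principle is carried out for [norm2] directly
    ([contraction_fixed_point]).
    Completeness enters one coordinate at a time, through the comparison of the
    increments of the orbit with a geometric series; [cvg_norm2] and
    [cvg_coord_norm2] pass between [norm2] and the entrywise topology of
    matrices. *)

(** * The Euclidean norm and its operator norm *)

Section EuclideanNorm.
Context {R : realType}.

Lemma norm20 n : norm2 (0 : 'cV[R]_n) = 0.
Proof.
by rewrite /norm2 big1 ?sqrtr0// => i _; rewrite mxE expr0n.
Qed.

Lemma norm2_eq0 n (x : 'cV[R]_n) : norm2 x = 0 -> x = 0.
Proof.
move=> x0; apply/matrixP => i j; rewrite (ord1 j) mxE; apply/normr0_eq0/eqP.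
by rewrite eq_le normr_ge0 andbT -x0 ler_norm2_coord.
Qed.

Lemma norm2_gt0 n (x : 'cV[R]_n) : x != 0 -> 0 < norm2 x.
Proof.
move=> x0; rewrite lt_neqAle norm2_ge0 andbT eq_sym.
by apply: contra_neq x0 => /norm2_eq0.
Qed.

Lemma sqr_norm2 n (x : 'cV[R]_n) : norm2 x ^+ 2 = \sum_(i < n) x i 0 ^+ 2.
Proof. by rewrite sqr_sqrtr// sumr_ge0// => i _; exact: sqr_ge0. Qed.

Lemma norm2N n (x : 'cV[R]_n) : norm2 (- x) = norm2 x.
Proof.
by congr (Num.sqrt _); apply: eq_bigr => i _; rewrite mxE sqrrN.
Qed.

Lemma le_norm2 n (x y : 'cV[R]_n) :
  (forall i, `|x i 0| <= `|y i 0|) -> norm2 x <= norm2 y.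
Proof.
move=> xy; rewrite ler_wsqrtr// ler_sum// => i _.
rewrite -(real_normK (num_real (x i 0))) -(real_normK (num_real (y i 0))).
by rewrite ler_sqr ?nnegrE.
Qed.

(** Cauchy-Schwarz: with [s = norm2 x], [t = norm2 y] and [d] the inner product,
    the squared norm of [t x - s y] is [2 s t (s t - d)], hence [d <= s t] as
    soon as [s t > 0]. *)
Lemma dot_le_norm2 n (x y : 'cV[R]_n) :
  \sum_(i < n) x i 0 * y i 0 <= norm2 x * norm2 y.
Proof.
have [->|x0] := eqVneq x 0.
  by rewrite norm20 mul0r big1// => i _; rewrite mxE mul0r.
have [->|y0] := eqVneq y 0.
  by rewrite norm20 mulr0 big1// => i _; rewrite mxE mulr0.
have s0 := norm2_gt0 x0; have t0 := norm2_gt0 y0.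
set s := norm2 x in s0 *; set t := norm2 y in t0 *; set d := \sum_(i < n) _.
have : 0 <= \sum_(i < n) (t * x i 0 - s * y i 0) ^+ 2.
  by apply: sumr_ge0 => i _; exact: sqr_ge0.
have -> : \sum_(i < n) (t * x i 0 - s * y i 0) ^+ 2
    = (s * t * (s * t - d)) *+ 2.
  under eq_bigr => i _ do rewrite sqrrB !exprMn.
  rewrite !big_split/= -!mulr_sumr -!sqr_norm2 -/s -/t sumrN sumrMnl.
  under [X in _ - X *+ 2]eq_bigr => i _ do rewrite mulrACA.
  by rewrite -mulr_sumr -/d; ring.
by rewrite pmulrn_lge0// pmulr_rge0 ?subr_ge0// mulr_gt0.
Qed.

Lemma ler_norm2D n (x y : 'cV[R]_n) : norm2 (x + y) <= norm2 x + norm2 y.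
Proof.
rewrite -ler_sqr ?nnegrE ?addr_ge0 ?norm2_ge0// sqrrD !sqr_norm2.
under eq_bigr => i _ do rewrite mxE sqrrD.
rewrite !big_split/= -mulr2n lerD2r lerD2l lerMn2r /=.
exact: dot_le_norm2.
Qed.

(** The convention [sup = 0] covers the case [n = 0], where the set of quotients
    is empty. *)
Lemma opnorm2_ge0 m n (A : 'M[R]_(m, n)) : 0 <= opnorm2 A.
Proof.
rewrite /opnorm2; set S := (X in sup X).
have [hS|/sup_out ->//] := pselect (has_sup S).
have [[r Sr] _] := hS.
apply: le_trans (sup_upper_bound hS Sr).
by case: Sr => x _ <-; rewrite divr_ge0 ?norm2_ge0.
Qed.

Lemma norm2_mulmx_opnorm2 m n (A : 'M[R]_(m, n)) (x : 'cV[R]_n) :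
  norm2 (A *m x) <= opnorm2 A * norm2 x.
Proof.
have [->|x0] := eqVneq x 0; first by rewrite mulmx0 !norm20 mulr0.
case: n => [|n] in A x x0 *; first by rewrite [x]flatmx0 eqxx in x0.
rewrite -ler_pdivrMr ?norm2_gt0//.
by apply: (sup_upper_bound (opnorm2_has_sup A)); exists x.
Qed.

(** The nonlinearity is harmless because of the reverse triangle inequality in
    each entry. *)
Lemma norm2_absvB n (x y : 'cV[R]_n) :
  norm2 (absv x - absv y) <= norm2 (x - y).
Proof. by apply: le_norm2 => i; rewrite !mxE ler_dist_dist. Qed.

(** A ball of the matrix topology is a product of balls of the entries, each of
    which is controlled by the Euclidean norm. *)
Lemma cvg_norm2 n (u : nat -> 'cV[R]_n) l :
  norm2 (l - u k) @[k --> \oo] --> 0 -> u k @[k --> \oo] --> l.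
Proof.
move=> /cvgr0Pnorm_lt ul; apply/cvg_ballP => e e0.
near=> k; split=> [//|i j]; rewrite (ord1 j) /ball /=.
have -> : l i 0 - u k i 0 = (l - u k) i 0 by rewrite !mxE.
apply: le_lt_trans (ler_norm2_coord _ _) _.
rewrite -[ltLHS]ger0_norm ?norm2_ge0//; near: k; exact: ul.
Unshelve. all: by end_near. Qed.

Lemma cvg_coord_norm2 n (u : nat -> 'cV[R]_n) (l : 'cV[R]_n) :
  (forall i, u k i 0 @[k --> \oo] --> l i 0) ->
  norm2 (l - u k) @[k --> \oo] --> 0.
Proof.
move=> ul.
apply: (@squeeze_cvgr _ _ _ _ (fun=> 0)
  (fun k => \sum_(i < n) `|(l - u k) i 0|)).
- by apply: nearW => k; rewrite norm2_ge0 norm2_le_sum.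
- exact: cvg_cst.
rewrite [X in _ --> X](_ : 0 = \sum_(i < n) (0 : R)); last by rewrite big1.
apply: cvg_big => [|i _]; first exact: add_continuous.
under eq_fun do rewrite !mxE.
have : `|l i 0 - u k i 0| @[k --> \oo] --> `|l i 0 - l i 0|.
  by apply: cvg_norm; apply: cvgB (ul i); exact: cvg_cst.
by rewrite subrr normr0.
Qed.

End EuclideanNorm.

(** * The contraction principle for the Euclidean norm *)

Section Contraction.
Context {R : realType} {n : nat}.
Variables (f : 'cV[R]_n -> 'cV[R]_n) (q : R).
Hypotheses (q_ge0 : 0 <= q) (q_lt1 : q < 1).
Hypothesis f_lip : forall x y, norm2 (f x - f y) <= q * norm2 (x - y).

Lemma contraction_fixed_unique x y : f x = x -> f y = y -> x = y.
Proof.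
move=> fx fy; apply/subr0_eq/norm2_eq0/eqP; rewrite eq_le norm2_ge0 andbT.
have := f_lip x y; rewrite fx fy -subr_ge0 -{2}[norm2 _]mul1r -mulrBl.
by rewrite nmulr_rge0 ?subr_lt0.
Qed.

Lemma iter_contractionB k x y :
  norm2 (iter k f x - iter k f y) <= q ^+ k * norm2 (x - y).
Proof.
elim: k => [|k IH]; first by rewrite expr0 mul1r.
by rewrite !iterS (le_trans (f_lip _ _))// exprS -mulrA ler_wpM2l.
Qed.

(** In each coordinate the increments of the orbit are dominated by
    [q ^+ k * norm2 (f x0 - x0)], so they form an absolutely convergent
    series of reals; the limits of the coordinates are the entries of [l]. *)
Lemma iter_contraction_cvg x0 : exists l : 'cV[R]_n,
  norm2 (l - iter k f x0) @[k --> \oo] --> 0.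
Proof.
pose u i k := iter k f x0 i 0.
suff cu i : cvgn (u i).
  exists (\col_i limn (u i)); apply: cvg_coord_norm2 => i.
  by rewrite mxE; exact: cu.
have /cvg_ex[s us] : cvgn (series (telescope (u i))).
  apply: normed_cvg.
  apply: (@series_le_cvg _ _ (geometric (norm2 (f x0 - x0)) q)).
  - by move=> k; exact: normr_ge0.
  - by move=> k; rewrite /geometric/= mulr_ge0 ?norm2_ge0 ?exprn_ge0.
  - move=> k; rewrite /geometric/= /telescope /u mulrC.
    apply: le_trans (iter_contractionB k _ _); rewrite -iterSr.
    by apply: le_trans (ler_norm2_coord _ i); rewrite !mxE.
  - by apply: is_cvg_geometric_series; rewrite ger0_norm.
apply/cvg_ex; exists (u i 0%N + s).
have : u i 0%N + series (telescope (u i)) k @[k --> \oo] --> u i 0%N + s.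
  by apply: cvgD => //; exact: cvg_cst.
by under eq_fun do rewrite -eq_sum_telescope.
Qed.

(** The limit [xs] of the orbit of [0] is fixed since, for every [k], its
    distance to [f xs] is at most [d (k + 1) + q d k], where [d k] is the
    distance from [xs] to the [k]-th iterate.  Any other orbit approaches the
    orbit of [xs], which is constant, at the rate [q ^+ k]. *)
Lemma contraction_fixed_point : exists xs,
  f xs = xs /\ forall x0, iter k f x0 @[k --> \oo] --> xs.
Proof.
have [xs cxs] := iter_contraction_cvg 0.
have fxs : f xs = xs.
  apply/esym/subr0_eq/norm2_eq0/eqP; rewrite eq_le norm2_ge0 andbT.
  pose v k := norm2 (xs - iter k f 0).
  have : v k.+1 + q * v k @[k --> \oo] --> 0 + q * 0.
    apply: cvgD; first by rewrite (@cvg_shiftS _ v).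
    by apply: cvgM => //; exact: cvg_cst.
  rewrite mulr0 addr0 => cv; rewrite -(cvg_lim _ cv)//.
  apply: limr_ge; first by apply/cvg_ex; exists 0.
  apply: nearW => k.
  rewrite -(subrKA (iter k.+1 f 0)) (le_trans (ler_norm2D _ _))// lerD2l.
  by rewrite -norm2N opprB iterS.
exists xs; split=> // x0; apply: cvg_norm2.
apply: (@squeeze_cvgr _ _ _ _ (fun=> 0) (geometric (norm2 (xs - x0)) q)).
- apply: nearW => k; rewrite norm2_ge0 /geometric/= mulrC.
  by rewrite -{1}(iter_fix k fxs) iter_contractionB.
- exact: cvg_cst.
- by apply: cvg_geometric; rewrite ger0_norm.
Qed.

End Contraction.

(** * The matrix splitting iteration *)

Section Iteration.
Context {R : realType} {n : nat}.
Implicit Types (M N Om B : 'M[R]_n) (b x y : 'cV[R]_n).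

Lemma nms_step_lipschitz M N Om B b x y :
  norm2 (nms_step M N Om B b x - nms_step M N Om B b y)
  <= (opnorm2 (invmx (M + Om) *m (N + Om)) + opnorm2 (invmx (M + Om) *m B))
     * norm2 (x - y).
Proof.
have -> : nms_step M N Om B b x - nms_step M N Om B b y
    = invmx (M + Om) *m (N + Om) *m (x - y)
      + invmx (M + Om) *m B *m (absv x - absv y).
  rewrite /nms_step -mulmxBr -!mulmxA -mulmxDr; congr (_ *m _).
  by rewrite !mulmxBr opprD addrACA subrr addr0 opprD addrACA.
rewrite mulrDl (le_trans (ler_norm2D _ _))// lerD ?norm2_mulmx_opnorm2//.
rewrite (le_trans (norm2_mulmx_opnorm2 _ _))// ler_wpM2l ?opnorm2_ge0//.
exact: norm2_absvB.
Qed.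

(** The residual [(M - N) x - B |x| - b] equals
    [(M + Om) x - ((N + Om) x + B |x| + b)], as the shift [Om] cancels. *)
Lemma nms_step_fixP M N Om B b x : M + Om \in unitmx ->
  nms_step M N Om B b x = x <-> (M - N) *m x - B *m absv x - b = 0.
Proof.
move=> uM.
have -> : (M - N) *m x - B *m absv x - b
    = (M + Om) *m x - ((N + Om) *m x + B *m absv x + b).
  by rewrite !opprD !addrA -mulmxBl opprD addrACA subrr addr0.
split=> [fx|/subr0_eq fx]; last by rewrite /nms_step -fx mulKmx.
by apply/eqP; rewrite subr_eq0 -{1}fx /nms_step mulKVmx.
Qed.

End Iteration.

Theorem corollary3 (R : realType) (n : nat) (A B Om M N : 'M[R]_n)
    (hA : A = M - N) (hinv : M + Om \in unitmx)
    (hnorm : opnorm2 (invmx (M + Om) *m (N + Om))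
             + opnorm2 (invmx (M + Om) *m B) < 1) :
  forall b : 'cV[R]_n,
  exists xs : 'cV[R]_n,
    unique (fun x : 'cV[R]_n => A *m x - B *m absv x - b = 0) xs
    /\ forall x0 : 'cV[R]_n, nms M N Om B b x0 k @[k --> \oo] --> xs.
Proof.
move=> b; subst A.
have lip := nms_step_lipschitz M N Om B b.
have q_ge0 := addr_ge0 (opnorm2_ge0 (invmx (M + Om) *m (N + Om)))
                       (opnorm2_ge0 (invmx (M + Om) *m B)).
have [xs [fxs cxs]] := contraction_fixed_point q_ge0 hnorm lip.
exists xs; split=> //; split; first exact/(nms_step_fixP N B b _ hinv).
move=> y /(nms_step_fixP N B b _ hinv) fy.
exact: (contraction_fixed_unique hnorm lip fxs fy).
Qed.
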